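(* Let $n,k\in\mathbb{N}$, let $s\geq 0$ be an integer, let $\mathbf{a}^{1},\dots,\mathbf{a}^{k}\in\mathbb{R}^{n}$ be pairwise linearly independent vectors, and let $f\in C^{s}(\mathbb{R}^{n})$ be a function of the form $$f(\mathbf{x})=\sum_{i=1}^{k}f_{i}(\mathbf{a}^{i}\cdot\mathbf{x}),\qquad \mathbf{x}\in\mathbb{R}^{n},$$ where $f_{1},\dots,f_{k}:\mathbb{R}\to\mathbb{R}$ are arbitrary functions (no regularity assumed). Suppose there is a nonsingular linear transformation $T:\mathbb{R}^{n}\to\mathbb{R}^{n}$ such that $T\mathbf{a}^{i}\in\mathbb{Q}^{n}$ for $i=1,\dots,k$. Then there exist functions $g_{i}\in C^{s}(\mathbb{R})$, $i=1,\dots,k$, such that $$f(\mathbf{x})=\sum_{i=1}^{k}g_{i}(\mathbf{a}^{i}\cdot\mathbf{x})\qquad\text{for all }\mathbf{x}\in\mathbb{R}^{n}.$$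
   Context: All functions are real-valued. $\mathbf{a}\cdot\mathbf{x}$ denotes the standard inner product on $\mathbb{R}^{n}$. $C^{s}(\mathbb{R}^{n})$ is the class of $s$-times continuously differentiable functions on $\mathbb{R}^{n}$, with the convention $C^{0}(\mathbb{R}^{n})=C(\mathbb{R}^{n})$ (continuous functions). *)

(* Defs.v *)
From HB Require Import structures.
From mathcomp Require Import all_boot all_order all_algebra.
From mathcomp Require Import all_classical all_reals all_analysis.
Set Implicit Arguments.
Unset Strict Implicit.
Unset Printing Implicit Defensive.
Import Order.TTheory GRing.Theory Num.Theory.
Import numFieldNormedType.Exports.
Local Open Scope classical_set_scope.
Local Open Scope ring_scope.

Definition dotv (R : realType) (n : nat) (a x : 'rV[R]_n) : R :=
  \sum_(j < n) a 0 j * x 0 j.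

(* C^s(R^n): all iterated partial derivatives of order at most s exist
   everywhere and are continuous.  The existence requirement has to be explicit
   because 'D_v f is a total function, with a junk value where f is not
   derivable; delta_mx 0 j is the j-th vector of the standard basis. *)
Fixpoint classC (R : realType) (n s : nat) (f : 'rV[R]_n -> R) : Prop :=
  match s with
  | 0 => continuous f
  | s'.+1 => continuous f /\
      forall j : 'I_n,
        (forall x : 'rV[R]_n, derivable f x (delta_mx 0 j)) /\
        classC s' (fun x : 'rV[R]_n => 'D_(delta_mx 0 j) f x)
  end.

(* C^s(R), through the library's iterated derivative derive1n m g, which is
   again total. *)
Definition classC1 (R : realType) (s : nat) (g : R -> R) : Prop :=
  (forall m : nat, (m < s)%N -> forall t : R, derivable (derive1n m g) t 1) /\
  continuous (derive1n s g).

Definition rational_vector (R : realType) (n : nat) (v : 'rV[R]_n) : Prop :=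
  exists q : 'rV[rat]_n, v = map_mx ratr q.

(* Main.v *)
Require Import Defs.
From HB Require Import structures.
From mathcomp Require Import all_boot all_order all_algebra.
From mathcomp Require Import all_classical all_reals all_analysis.
From mathcomp Require Import zify ring lra.
Set Implicit Arguments.
Unset Strict Implicit.
Unset Printing Implicit Defensive.
Import Order.TTheory GRing.Theory Num.Theory.
Import numFieldNormedType.Exports.
Local Open Scope classical_set_scope.
Local Open Scope ring_scope.

(** Existence of continuous components.  Taking steps along vectors [b j] with
    [a i . b j = 1] and [a j . b j = 0] in an iterated difference of [f] kills
    every summand but the [i]-th, so the iterated differences of
    [phi = f_i | Q] of order [k - 1] are bounded on bounded sets, and one more
    small step makes them small.  Both properties pass from differences of
    order [m + 1] to order [m]: the order [m] difference is an approximately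
    additive function of each of its steps, and additive functions on [Q] are
    linear.  Hence [phi] is uniformly continuous on bounded sets and extends to
    a continuous [g_i] on [R].  The points at which all [a i . x] are rational
    are dense because [T] makes the [a i] rational, so [f = sum g_i (a i . x)].

    Regularity.  The operator [J_b f x = int_0^1 f (x + h b) dh - f x] maps
    ridge sums to ridge sums, preserves C^1, and kills the [j]-th summand when
    [a j . b = 0].  When [a i . b = 1] it sends the [i]-th component [g] to
    [int_0^1 g (t + h) dh - g t], whose first term is C^1, so [g] is C^1 as
    soon as its image is.  Removing all other summands shows that each [g_i]
    is C^1; one then differentiates the representation and inducts on [s]. *)

(** * Iterated differences on the rationals *)

Section differences.
Context {V W : zmodType}.
Implicit Types (v x : V) (vs : seq V) (F : V -> W).

(** The recursion moves the base point; [diffs_step] gives the form in which the first step acts on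
    [F] itself. *)
Fixpoint diffs vs F x : W :=
  if vs is v :: vs' then diffs vs' F (x + v) - diffs vs' F x else F x.

Lemma diffs_move v vs ws F x :
  diffs (vs ++ v :: ws) F x = diffs (v :: vs ++ ws) F x.
Proof.
elim: vs x => //= u vs IH x; rewrite !IH /= [x + v + u]addrAC.
by rewrite !opprD !opprK addrACA.
Qed.

Lemma diffs_step v vs F x :
  diffs (v :: vs) F x = diffs vs (fun y => F (y + v) - F y) x.
Proof.
elim: vs x => //= u vs IH x; rewrite -!IH /= [x + v + u]addrAC.
by rewrite !opprD !opprK addrACA.
Qed.

Lemma diffs_sum (I : finType) (F : I -> V -> W) vs x :
  diffs vs (fun y => \sum_i F i y) x = \sum_i diffs vs (F i) x.
Proof. by elim: vs x => //= v vs IH x; rewrite !IH -sumrB. Qed.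

Lemma diffs_mem0 vs F x : 0 \in vs -> diffs vs F x = 0.
Proof.
elim: vs x => //= v vs IH x; rewrite inE => /predU1P[<-|/IH vs0].
  by rewrite addr0 subrr.
by rewrite !vs0 subrr.
Qed.

Lemma eq_diffs F G : F =1 G -> forall vs x, diffs vs F x = diffs vs G x.
Proof. by move=> FG; elim=> //= v vs IH x; rewrite !IH. Qed.

End differences.

Lemma diffs_comp (U V W : zmodType) (l : U -> V) (F : V -> W) (us : seq U) (x : U) :
  (forall y z, l (y + z) = l y + l z) ->
  diffs us (fun y => F (l y)) x = diffs (map l us) F (l x).
Proof. by move=> lD; elim: us x => //= u us IH x; rewrite !IH lD. Qed.

(** With [S] the shift by [v], this is S^2 - 1 = 2 (S - 1) + (S - 1)^2. *)
Lemma diffs_double (R : realType) (V : zmodType) (v : V) (vs : seq V)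
    (F : V -> R) (x : V) :
  diffs (v + v :: vs) F x = diffs (v :: vs) F x *+ 2 + diffs [:: v, v & vs] F x.
Proof. by rewrite /= [x + (v + v)]addrA; ring. Qed.

(** The difference is a signed sum of [2 ^ size vs] values of [F], at points that stay in the ball
    of the hypothesis. *)
Lemma diffs_bound (R : realType) (V : normedModType R) (F : V -> R)
    (vs : seq V) (x : V) (r C : R) :
  0 <= r -> all (fun v => `|v| <= r) vs ->
  (forall y, `|y| <= `|x| + r *+ size vs -> `|F y| <= C) ->
  `|diffs vs F x| <= C *+ 2 ^ size vs.
Proof.
move=> r0; elim: vs x => [|v vs IH] x /=.
  by move=> _ FC; rewrite expn0 mulr1n; apply: FC; rewrite addr0.
move=> /andP[vr vsr] FC.
rewrite (le_trans (ler_normB _ _))// expnS mul2n -addnn mulrnDr lerD//.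
  apply: IH => // y yx; apply: FC; rewrite mulrS addrA.
  rewrite (le_trans yx)// lerD2r (le_trans (ler_normD _ _))// lerD2l.
  exact: vr.
apply: IH => // y yx; apply: FC; rewrite mulrS addrA.
by rewrite (le_trans yx)// lerD2r lerDl.
Qed.

(** * Approximately additive functions on bounded intervals *)

Section approximately_additive.
Context {R : realType}.

(* At a point where [`|A|] is maximal, [A (x *+ 2)] is close to [A x *+ 2],
   so the maximum is controlled unless [x] lies in the outer half of the
   interval, and then one first translates by [L]. *)
Lemma approx_additive_int (A : int -> R) (L : nat) (C : R) :
  (forall x y : int, `|x| <= L%:Z -> `|y| <= L%:Z -> `|x + y| <= L%:Z ->
     `|A (x + y) - A x - A y| <= C) ->
  forall x : int, `|x| <= L%:Z -> `|A x| <= `|A L| *+ 2 + C *+ 3.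
Proof.
move=> AC x xL.
have C0 : 0 <= C by apply: le_trans (AC 0 0 _ _ _); rewrite ?addr0 ?normr0.
pose pt (i : 'I_(L + L).+1) : int := i%:Z - L%:Z.
have ptL i : `|pt i| <= L%:Z by rewrite /pt; have := ltn_ord i; lia.
have ptK (y : int) : `|y| <= L%:Z -> exists i, y = pt i.
  move=> yL; have H : (absz (y + L%:Z)%R < (L + L).+1)%N by lia.
  by exists (Ordinal H); rewrite /pt /=; lia.
have [i _ imax] := @arg_maxP _ _ _ ord0 xpredT (fun i => `|A (pt i)|) erefl.
set y := pt i in imax; set K := `|A y| in imax.
have AK (z : int) : `|z| <= L%:Z -> `|A z| <= K by move=> /ptK[j ->]; exact: imax.
have half (z : int) : `|z + z| <= L%:Z -> `|A z| *+ 2 <= K + C.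
  move=> zL; have zL' : `|z| <= L%:Z by lia.
  have -> : `|A z| *+ 2 = `|A (z + z) - (A (z + z) - A z - A z)|.
    by rewrite -normrMn mulr2n; congr `|_|; ring.
  by rewrite (le_trans (ler_normB _ _))// lerD ?AK ?AC.
have tri (z w : int) : `|z| <= L%:Z -> `|w| <= L%:Z -> `|z + w| <= L%:Z ->
    `|A (z + w)| <= `|A z| + `|A w| + C.
  move=> zL wL zwL.
  have -> : A (z + w) = A z + A w + (A (z + w) - A z - A w) by ring.
  by rewrite (le_trans (ler_normD _ _))// lerD ?AC ?ler_normD.
suff : K <= `|A L| *+ 2 + C *+ 3 by apply: le_trans; exact: AK.
have yL := ptL i; rewrite -/y in yL.
have AL0 : 0 <= `|A L| by [].
have LL : `|L%:Z| <= L%:Z by lia.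
have [yy|yy] := leP `|y + y| L%:Z.
  by have := half _ yy; rewrite -/K; lra.
(* Now [y] lies farther than [L / 2] from 0, so its translate by [L] towards 0 lies in the inner
   half, where [half] applies. This gives [K <= |A L| + (K + C) / 2 + C], which solves to the
   claimed bound. *)
have [y0|y0] := leP 0 y.
  have h1 : `|(y - L%:Z) + (y - L%:Z)| <= L%:Z by lia.
  have h2 : `|y - L%:Z| <= L%:Z by lia.
  have := tri L (y - L%:Z) LL h2; rewrite [_ + (y - _)]addrC subrK => /(_ yL).
  by have := half _ h1; rewrite -/K; lra.
have h1 : `|(y + L%:Z) + (y + L%:Z)| <= L%:Z by lia.
have h2 : `|y + L%:Z| <= L%:Z by lia.
have : K <= `|A (y + L%:Z)| + `|A L| + C.
  have -> : K = `|(A (y + L%:Z) - A L) - (A (y + L%:Z) - A y - A L)|.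
    by congr `|_|; ring.
  by rewrite (le_trans (ler_normB _ _))// lerD ?AC ?ler_normB.
by have := half _ h1; lra.
Qed.


(** The grid of multiples of [1 / d], with [d] the denominator of [x], contains both [x] and [M],
    and the integer bound on it does not depend on [d]. *)
Lemma approx_additive_rat (A : rat -> R) (M : nat) (C : R) :
  (forall x y : rat, `|x| <= M%:R -> `|y| <= M%:R -> `|x + y| <= M%:R ->
     `|A (x + y) - A x - A y| <= C) ->
  forall x : rat, `|x| <= M%:R -> `|A x| <= `|A M%:R| *+ 2 + C *+ 3.
Proof.
move=> AC x xM.
pose d := denq x; have d0 : 0 < d%:~R :> rat by rewrite ltr0z denq_gt0.
pose L := (M * `|d|)%N.
have dE : (`|d|%N)%:R = d%:~R :> rat.
  by rewrite -[RHS](ger0_norm (ltW d0)) -intr_norm -abszE pmulrn.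
have LE : L%:R / d%:~R = M%:R :> rat by rewrite natrM dE mulfK// gt_eqF.
pose B (z : int) := A (z%:~R / d%:~R).
have nB (z : int) : `|z| <= L%:Z -> `|z%:~R / d%:~R| <= M%:R :> rat.
  move=> zL; rewrite -LE normrM (gtr0_norm (_ : 0 < d%:~R^-1)) ?invr_gt0//.
  by rewrite ler_pM2r ?invr_gt0// -intr_norm -[L%:R]/(L%:Z%:~R) ler_int.
have := @approx_additive_int B L C _ (numq x); rewrite /B divq_num_den.
rewrite [L%:~R / _]LE; apply.
  move=> y z yL zL yzL.
  by rewrite /B intrD mulrDl; apply: AC; rewrite -?mulrDl -?intrD; exact: nB.
move: xM; rewrite -LE -{1}(divq_num_den x) normrM.
rewrite (gtr0_norm (_ : 0 < d%:~R^-1)) ?invr_gt0//.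
by rewrite ler_pM2r ?invr_gt0// -intr_norm -[L%:R]/(L%:Z%:~R) ler_int.
Qed.

End approximately_additive.

(** * Lowering the order of the differences *)

Definition bounded_diffs (R : realType) (m : nat) (phi : rat -> R) : Prop :=
  forall M : nat, exists C : R, forall (hs : seq rat) (t : rat),
    size hs = m -> all (fun h => `|h| <= M%:R) hs -> `|t| <= M%:R ->
    `|diffs hs phi t| <= C.

(** Only [h] is small; the other [m] steps are merely bounded. For [m = 0] this is uniform
    continuity on bounded sets of rationals. *)
Definition small_diffs (R : realType) (m : nat) (phi : rat -> R) : Prop :=
  forall (M : nat) (e : R), 0 < e -> exists2 d : rat, 0 < d &
    forall (h : rat) (hs : seq rat) (t : rat),
    size hs = m -> all (fun h => `|h| <= M%:R) hs -> `|t| <= M%:R ->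
    `|h| <= d -> `|diffs (h :: hs) phi t| <= e.

(* The steps are replaced by [M] one at a time: as a function of each step, a
   difference of order [m] is additive up to a difference of order [m + 1]. *)
Lemma bounded_diffsS (R : realType) (m : nat) (phi : rat -> R) :
  bounded_diffs m.+1 phi -> bounded_diffs m phi.
Proof.
move=> bphi M; have [C HC] := bphi M.
(* Here [i] steps are already equal to [M] and [j] steps are still free. *)
suff : forall j, exists C', forall (rest : seq rat) (t : rat) i, size rest = j ->
    (i + j)%N = m -> all (fun h => `|h| <= M%:R) rest -> `|t| <= M%:R ->
    `|diffs (nseq i M%:R ++ rest) phi t| <= C'.
  move=> /(_ m)[C' HC']; exists C' => hs t sz hsM tM.
  exact: (HC' hs t 0%N).
have MM : `|M%:R| <= M%:R :> rat by rewrite normr_nat.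
elim=> [|j [C' IH]].
  (* Once all steps are [M], only the base point varies, and moving it from 0 to [t] adds a
     difference of order [m + 1] with first step [t]. *)
  exists (`|diffs (nseq m M%:R) phi 0| + C) => -[|//] t i _.
  rewrite addn0 => -> _ tM.
  rewrite cats0.
  have -> : diffs (nseq m M%:R) phi t =
      diffs (nseq m M%:R) phi 0 + diffs (t :: nseq m M%:R) phi 0.
    by rewrite /= add0r; ring.
  rewrite (le_trans (ler_normD _ _))// lerD2l; apply: HC.
  - by rewrite /= size_nseq.
  - by rewrite /= tM all_nseq MM orbT.
  - by rewrite normr0.
exists (C' *+ 2 + C *+ 3) => -[//|h rest] t i [sz] ijm /= /andP[hM restM] tM.
rewrite diffs_move.
pose A h := diffs (h :: nseq i M%:R ++ rest) phi t.
have AC (x y : rat) : `|x| <= M%:R -> `|y| <= M%:R -> `|x + y| <= M%:R ->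
    `|A (x + y) - A x - A y| <= C.
  move=> xM yM _.
  have -> : A (x + y) - A x - A y = diffs (y :: x :: nseq i M%:R ++ rest) phi t.
    by rewrite /A /= [t + (x + y)]addrA [t + x + y]addrAC; ring.
  apply: HC => //.
    by rewrite /= size_cat size_nseq sz -ijm addnS.
  by rewrite /= yM xM all_cat restM all_nseq MM orbT.
rewrite (le_trans (approx_additive_rat AC hM))// lerD2r lerMn2r /=.
by apply: (IH rest t i.+1) => //; rewrite -ijm addSnnS.
Qed.

(* By [diffs_double], the difference for the step [h] is half the one for
   [h + h], up to a small error; one doubles until the step has size about [d]. *)
Lemma small_diffsS (R : realType) (m : nat) (phi : rat -> R) :
  bounded_diffs m.+1 phi -> small_diffs m.+1 phi -> small_diffs m phi.
Proof.
move=> bphi sphi M e e0; have e20 : 0 < e / 2 by rewrite divr_gt0.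
(* With [M.+1] the step [h], of size at most 1, is admissible among the bounded steps even when
   [M = 0]. *)
have [C HC] := bphi M.+1.
have [d d0 Hd] := sphi M.+1 _ e20.
pose d1 := Num.min d 1.
have d1M : d1 <= M.+1%:R by rewrite ge_min ler1n orbT.
have MM1 : M%:R <= M.+1%:R :> rat by rewrite ler_nat.
(* The step [h] can be doubled [r] times without exceeding [d1]. Each doubling halves the first
   term, and the error reproduces itself: [(e / 2 + e / 2) / 2 = e / 2]. *)
have step (h : rat) hs (t : rat) r : size hs = m ->
    all (fun h => `|h| <= M%:R) hs -> `|t| <= M%:R -> `|h| *+ 2 ^ r <= d1 ->
    `|diffs (h :: hs) phi t| <= C / 2 ^+ r + e / 2.
  move=> sz hsM tM.
  have hsM1 : all (fun h => `|h| <= M.+1%:R) hs.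
    by apply: sub_all hsM => x /le_trans; apply.
  have tM1 : `|t| <= M.+1%:R by exact: le_trans tM MM1.
  elim: r h => [|r IH] h hd.
    rewrite expr0 divr1; apply: (ler_wpDr (ltW e20)); apply: HC => //=.
      by rewrite sz.
    by rewrite hsM1 andbT (le_trans _ d1M)// -[`|h|]mulr1n.
  have := IH (h + h).
  rewrite -mulr2n normrMn -mulrnA -expnS => /(_ hd).
  have hd1 : `|h| <= d1.
    by rewrite (le_trans _ hd)// -[leLHS]mulr1n ler_wpMn2l// expn_gt0.
  have : `|diffs [:: h, h & hs] phi t| <= e / 2.
    apply: Hd => //=; first by rewrite sz.
      by rewrite hsM1 andbT (le_trans hd1).
    by rewrite (le_trans hd1)// ge_min lexx.
  rewrite mulr2n diffs_double => h2 h1.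
  have : `|diffs (h :: hs) phi t *+ 2| <= C / 2 ^+ r + e / 2 + e / 2.
    rewrite -[_ *+ 2](addrK (diffs [:: h, h & hs] phi t)).
    by rewrite (le_trans (ler_normB _ _))// lerD.
  rewrite normrMn exprS invfM.
  set X := `|_|; set Y := (2 ^+ r)^-1.
  have -> : C * (2^-1 * Y) = (C * Y) / 2 by ring.
  by move=> ?; lra.
have [r Cr] : exists r, C / 2 ^+ r <= e / 2.
  exists (Num.bound (C / (e / 2))); rewrite ler_pdivrMr ?exprn_gt0// mulrC.
  by rewrite -ler_pdivrMr//; apply/ltW/Num.Theory.upper_nthrootP.
exists (d1 / (2 ^ r)%:R) => [|h hs t sz hsM tM hd].
  by rewrite divr_gt0 ?lt_min ?d0// ltr0n expn_gt0.
rewrite [leRHS]splitr (le_trans (step _ _ _ r _ _ _ _))// ?lerD2r//.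
by rewrite -mulr_natr -ler_pdivlMr// ltr0n expn_gt0.
Qed.

Lemma small_diffs0 (R : realType) (m : nat) (phi : rat -> R) :
  bounded_diffs m phi -> small_diffs m phi -> small_diffs 0 phi.
Proof.
elim: m => // m IH bphi sphi.
by apply: IH; [exact: bounded_diffsS|exact: small_diffsS].
Qed.

(** * Averages over the unit interval *)

Section unit_average.
Context {R : realType}.
Notation mu := (@lebesgue_measure R).

Definition avg01 (F : R -> R) : R := \int[mu]_(h in `[0, 1]) F h.

Lemma integrable01 (F : R -> R) : continuous F ->
  mu.-integrable `[0, 1] (EFin \o F).
Proof.
move=> cF; apply: continuous_compact_integrable; first exact: segment_compact.
exact: continuous_subspaceT.
Qed.

Lemma avg01B (F G : R -> R) : continuous F -> continuous G ->
  avg01 (fun h => F h - G h) = avg01 F - avg01 G.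
Proof. by move=> cF cG; rewrite /avg01 RintegralB//; exact: integrable01. Qed.

Lemma avg01_cst (r : R) : avg01 (fun=> r) = r.
Proof.
rewrite /avg01 Rintegral_cst//.
rewrite [X in _ * fine X](_ : _ = 1%E) ?mulr1//.
apply: etrans (lebesgue_measure_itv `[0, 1]%R) _.
by rewrite /= lte_fin ltr01 oppr0 adde0.
Qed.

Lemma avg01_dist (F G : R -> R) (e : R) : continuous F -> continuous G ->
  (forall h, `[0, 1]%classic h -> `|F h - G h| <= e) ->
  `|avg01 F - avg01 G| <= e.
Proof.
move=> cF cG FGe.
have cFG : continuous (fun h => F h - G h).
  by move=> x; apply: cvgB; [exact: cF|exact: cG].
rewrite -avg01B// (le_trans (le_normr_Rintegral _ _))//; first exact: integrable01.
rewrite -[leRHS]avg01_cst; apply: le_Rintegral => //; apply: integrable01.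
  by move=> x; apply: cvg_norm; exact: cFG.
by move=> x; exact: cvg_cst.
Qed.

(** Compactness of the interval makes the neighbourhood of [x] independent of [h]. Both continuity
    of averages and differentiation under the integral rest on this. *)
Lemma near_dist_on01 (X : topologicalType) (F : X -> R -> R) (e : R) (x : X) :
  continuous (fun p : X * R => F p.1 p.2) -> 0 < e ->
  \forall y \near x, forall h, `[0, 1]%classic h -> `|F x h - F y h| <= e.
Proof.
move=> cF e0.
have /compact_near_coveringP/(_ X (nbhs x)) : compact `[(0:R), 1]%classic.
  exact: segment_compact.
move=> /(_ (fun y h => `|F x h - F y h| <= e)); apply.
move=> h h01.
have e20 : 0 < e / 2 by rewrite divr_gt0.
have /cvgrPdist_le/(_ _ e20) := cF (x, h).
move=> [[A B] /= [Ax Bh]] AB.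
exists (B, A) => //= -[h' y] /= [Bh' Ay].
have h1 := AB (y, h') (conj Ay Bh').
have h2 := AB (x, h') (conj (nbhs_singleton Ax) Bh').
rewrite /= in h1 h2; rewrite (splitr e).
have -> : F x h' - F y h' = (F x h - F y h') - (F x h - F x h') by ring.
by rewrite (le_trans (ler_normB _ _))// lerD.
Qed.

Lemma continuous_slice (X : topologicalType) (F : X -> R -> R) (x : X) :
  continuous (fun p : X * R => F p.1 p.2) -> continuous (F x).
Proof.
move=> cF h.
apply: (@continuous_comp _ _ _ (fun h' => (x, h')) (fun p => F p.1 p.2)).
  by apply: (@cvg_pair _ _ _ _ (nbhs x) (nbhs h)); [exact: cvg_cst|exact: cvg_id].
exact: cF.
Qed.

Lemma continuous_avg01 (X : topologicalType) (F : X -> R -> R) :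
  continuous (fun p : X * R => F p.1 p.2) -> continuous (fun x => avg01 (F x)).
Proof.
move=> cF x; apply/cvgrPdist_le => e e0.
have := near_dist_on01 x cF e0; apply: filterS => y ye.
by apply: avg01_dist => //; exact: continuous_slice.
Qed.

(** The average is [P (u + 1) - P u] for a primitive [P] of [g]. This is where one derivative is
    gained from mere continuity. *)
Lemma is_derive_avg01_shift (g : R -> R) (t : R) : continuous g ->
  is_derive t 1 (fun u => avg01 (fun h => g (u + h))) (g (t + 1) - g t).
Proof.
move=> cg.
(* Starting at [t - 1] leaves every [u] near [t], as well as [u + 1], where [P] has a two-sided
   derivative. *)
pose P x := \int[mu]_(y in `[t - 1, x]) g y.
have dP (x : R) : t - 1 < x -> is_derive x 1 P (g x).
  move=> tx; have x1 : x < x + 1 by rewrite ltrDl.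
  have gi : mu.-integrable `[t - 1, x + 1] (EFin \o g).
    apply: continuous_compact_integrable; first exact: segment_compact.
    exact: continuous_subspaceT.
  have [d <-] := continuous_FTC1_closed x1 gi tx (cg x).
  by rewrite derive1E; exact: DeriveDef.
have dPs (x c : R) : t - 1 < x + c ->
    is_derive x 1 (fun u => P (u + c)) (g (x + c)).
  move=> xc; have h1 := dP _ xc.
  rewrite -[g _]mulr1; apply: (@is_derive1_comp R P (fun u => u + c)) h1 _.
  exact: is_derive_shift.
have avgE (u : R) : t - 1 < u -> avg01 (fun h => g (u + h)) = P (u + 1) - P (u + 0).
  move=> tu.
  have dPh (h : R) : 0 <= h -> is_derive h 1 (fun h => P (u + h)) (g (u + h)).
    move=> h0.
    under eq_fun do rewrite addrC.
    by rewrite addrC; apply: dPs; rewrite (lt_le_trans tu)// addrC lerDl.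
  have cPh (h : R) : 0 <= h -> {for h, continuous (fun h => P (u + h))}.
    move=> /dPh [+ _] => /derivable1_diffP; exact: differentiable_continuous.
  rewrite /avg01 /Rintegral (@continuous_FTC2 _ _ (fun h => P (u + h)))//.
  - apply: continuous_subspaceT => h.
    apply: continuous_comp; last exact: cg.
      by apply: cvgD; [exact: cvg_cst|exact: cvg_id].
  - split.
    + by move=> h /[!in_itv]/= /andP[/ltW h0 _]; by have [] := dPh _ h0.
    + by apply: cvg_at_right_filter; exact: cPh.
    + by apply: cvg_at_left_filter; exact: cPh.
  - move=> h /[!in_itv]/= /andP[/ltW h0 _].
    by rewrite derive1E; have [] := dPh _ h0.
apply: (@near_eq_is_derive R R R (fun u => P (u + 1) - P (u + 0)) _ t 1).
  near=> u; rewrite avgE//; near: u.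
  by apply: lt_nbhsr; rewrite ltrBlDr ltrDl.
have -> : g t = g (t + 0) by rewrite addr0.
by apply: is_deriveB; apply: dPs; lra.
Unshelve. all: by end_near. Qed.

End unit_average.

(** * Directional derivatives along lines and under the average *)

Section directional.
Context {R : realType} {V : normedModType R}.
Implicit Types (f : V -> R) (e x b : V).

Let line_quotient f e x (t : R) :
  (fun h : R => h^-1 *: (((fun u => f (x + u *: e)) \o shift t) (h *: (1 : R))
                         - f (x + t *: e))) =
  (fun h : R => h^-1 *: ((f \o shift (x + t *: e)) (h *: e) - f (x + t *: e))).
Proof.
apply/funext => h /=; congr (_ *: (f _ - _)).
by rewrite [h *: 1]mulr1 scalerDl addrCA.
Qed.

Lemma derivable_line f e x (t : R) :
  derivable (fun u : R => f (x + u *: e)) t 1 = derivable f (x + t *: e) e.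
Proof. by rewrite /derivable line_quotient. Qed.

Lemma derive_line f e x (t : R) :
  'D_1 (fun u : R => f (x + u *: e)) t = 'D_e f (x + t *: e).
Proof. by rewrite /derive line_quotient. Qed.

Lemma is_derive_line f e x (t : R) : derivable f (x + t *: e) e ->
  is_derive t 1 (fun u : R => f (x + u *: e)) ('D_e f (x + t *: e)).
Proof.
by move=> df; rewrite -derive_line; apply/derivableP; rewrite derivable_line.
Qed.

Lemma MVT_line f e x (u : R) : (forall y, derivable f y e) ->
  exists2 c : R, `|c| <= `|u| &
    f (x + u *: e) - f x = u * 'D_e f (x + c *: e).
Proof.
move=> df.
pose g (t : R) := f (x + t *: e).
have dg (t : R) : is_derive t 1 g ('D_e f (x + t *: e)) by exact: is_derive_line.
have cg : continuous g.
  move=> t; apply: differentiable_continuous.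
  by apply/derivable1_diffP; have [] := dg t.
have g0 : g 0 = f x by rewrite /g scale0r addr0.
have [u0|/ltW u0] := leP 0 u.
  have [|c /[!in_itv]/= /andP[c0 cu]] :=
    @MVT_segment R g _ 0 u u0 (fun t _ => dg t).
    exact: continuous_subspaceT.
  by rewrite g0 subr0 mulrC => E; exists c => //; rewrite !ger0_norm.
have [|c /[!in_itv]/= /andP[uc c0]] := @MVT_segment R g _ u 0 u0 (fun t _ => dg t).
  exact: continuous_subspaceT.
rewrite g0 sub0r => E; exists c; first by rewrite !ler0_norm// lerN2.
by rewrite -/(g u) -[LHS]opprB E mulrN opprK mulrC.
Qed.

Lemma continuous_translates f b : continuous f ->
  continuous (fun p : V * R => f (p.1 + p.2 *: b)).
Proof.
move=> cf p; apply: (@continuous_comp _ _ _ (fun p : V * R => p.1 + p.2 *: b) f).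
  apply: cvgD; first exact: cvg_fst.
  by apply: cvgZr_tmp; exact: cvg_snd.
exact: cf.
Qed.

Lemma continuous_along f b x : continuous f ->
  continuous (fun h : R => f (x + h *: b)).
Proof.
move=> cf; apply: (@continuous_slice _ _ (fun x h => f (x + h *: b))).
exact: continuous_translates.
Qed.

(** By [MVT_line] the difference quotient of the integrand is ['D_e f] at a point displaced by
    [c *: e] with [|c| <= |u|], and [near_dist_on01] makes its convergence uniform in [h]. *)
Lemma is_derive_avg01 f e b x : continuous f ->
  (forall y, derivable f y e) -> continuous ('D_e f) ->
  is_derive x e (fun y => avg01 (fun h => f (y + h *: b)))
    (avg01 (fun h => 'D_e f (x + h *: b))).
Proof.
move=> cf df cdf.
suff H : (fun u : R => u^-1 *: (((fun y => avg01 (fun h => f (y + h *: b)))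
     \o shift x) (u *: e) - avg01 (fun h => f (x + h *: b)))) @ 0^'
    --> avg01 (fun h => 'D_e f (x + h *: b)).
  apply: DeriveDef; last exact: cvg_lim H.
  by apply/cvg_ex; eexists; exact: H.
apply/cvgrPdist_le => eps eps0.
pose F (u h : R) := 'D_e f (x + u *: e + h *: b).
have cF : continuous (fun p : R * R => F p.1 p.2).
  move=> p; apply: (@continuous_comp _ _ _
    (fun p : R * R => x + p.1 *: e + p.2 *: b) ('D_e f)).
    apply: cvgD; first (apply: cvgD; first exact: cvg_cst).
      by apply: cvgZr_tmp; exact: cvg_fst.
    by apply: cvgZr_tmp; exact: cvg_snd.
  exact: cdf.
have := near_dist_on01 0 cF eps0.
rewrite -nbhs_nearE => /nbhs_ballP[d /= d0 Hd].
apply/nbhs_ballP; exists d => //= u; rewrite -ball_normE /= sub0r normrN => ud u0.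
have cfu y : continuous (fun h : R => f (y + h *: b)) by exact: continuous_along.
have -> : u^-1 *: (avg01 (fun h => f (u *: e + x + h *: b)) -
     avg01 (fun h => f (x + h *: b))) =
   avg01 (fun h => u^-1 * (f (u *: e + x + h *: b) - f (x + h *: b))).
  rewrite -avg01B// /avg01 RintegralZl//.
  apply: integrable01 => h; apply: cvgB; exact: cfu.
apply: avg01_dist => [||h h01]; first exact: (@continuous_along ('D_e f)).
  move=> h; apply: cvgM; first exact: cvg_cst.
  by apply: cvgB; exact: cfu.
have [c cu Ec] := MVT_line (x + h *: b) u df.
rewrite [u *: e + x]addrC addrAC Ec mulKf//.
have /(_ h h01) : forall h, `[0, 1]%classic h -> `|F 0 h - F c h| <= eps.
  by apply: Hd; rewrite -ball_normE /= sub0r normrN (le_lt_trans cu).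
by rewrite /F scale0r addr0 [x + c *: e + _]addrAC.
Qed.

End directional.

(** * Regularity of continuous components *)

Lemma continuous_bigsum (R : realType) (W : normedModType R)
    (T : topologicalType) (I : Type) (r : seq I) (P : pred I) (F : I -> T -> W) :
  (forall i, continuous (F i)) -> continuous (fun x => \sum_(i <- r | P i) F i x).
Proof.
move=> cF; elim: r => [|i r IH].
  by under eq_fun do rewrite big_nil; move=> x; exact: cvg_cst.
under eq_fun do rewrite big_cons; case: (P i) => // x.
by apply: cvgD; [exact: cF|exact: IH].
Qed.

Lemma avg01_sum (R : realType) (I : Type) (r : seq I) (P : pred I)
    (F : I -> R -> R) : (forall i, continuous (F i)) ->
  avg01 (fun h => \sum_(i <- r | P i) F i h) = \sum_(i <- r | P i) avg01 (F i).
Proof.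
move=> cF; elim: r => [|i r IH].
  by under eq_fun do rewrite big_nil; rewrite avg01_cst big_nil.
under eq_fun do rewrite big_cons.
rewrite big_cons; case: (P i) => //; rewrite /avg01 RintegralD//.
- by congr (_ + _); exact: IH.
- exact: integrable01.
- exact/integrable01/continuous_bigsum.
Qed.

Section dotv_theory.
Context {R : realType} {n : nat}.
Implicit Types a x y : 'rV[R]_n.

Lemma dotvDr a x y : dotv a (x + y) = dotv a x + dotv a y.
Proof. by rewrite -big_split; apply: eq_bigr => j _; rewrite mxE mulrDr. Qed.

Lemma dotvZr a (c : R) x : dotv a (c *: x) = c * dotv a x.
Proof. by rewrite mulr_sumr; apply: eq_bigr => j _; rewrite mxE mulrCA. Qed.

Lemma dotv0l x : dotv 0 x = 0.
Proof. by rewrite /dotv big1// => j _; rewrite mxE mul0r. Qed.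

Lemma dotv_delta a (j : 'I_n) : dotv a (delta_mx 0 j) = a 0 j.
Proof.
rewrite /dotv (bigD1 j)//= mxE !eqxx mulr1 big1 ?addr0// => i /negPf ij.
by rewrite mxE ij andbF mulr0.
Qed.

Lemma continuous_dotv a : continuous (dotv a).
Proof.
apply: continuous_bigsum => j x.
apply: (@continuousM R 'rV[R]_n (cst (a 0 j)) (fun y => y 0 j)).
  exact: cst_continuous.
exact: coord_continuous.
Qed.

End dotv_theory.

Definition is_C1 (R : realType) (g : R -> R) : Prop :=
  exists2 g' : R -> R, continuous g' & forall t : R, is_derive t 1 g (g' t).

Lemma is_C1B (R : realType) (g1 g2 : R -> R) :
  is_C1 g1 -> is_C1 g2 -> is_C1 (fun t => g1 t - g2 t).
Proof.
move=> [g1' c1 d1] [g2' c2 d2]; exists (fun t => g1' t - g2' t).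
  by move=> t; apply: cvgB; [exact: c1|exact: c2].
by move=> t; apply: is_deriveB.
Qed.

Section ridge_regularity.
Context {R : realType} {n : nat} {I : finType} (a : I -> 'rV[R]_n).
Hypothesis separated : forall i j, i != j ->
  exists b, dotv (a i) b = 1 /\ dotv (a j) b = 0.

(* The induction removes a summand [j != i] by replacing [f x] with
   [avg01 (fun h => f (x + h *: b)) - f x], where [a j . b = 0]. *)
Lemma ridge_sum_C1 (A : {set I}) (i : I) (f : 'rV[R]_n -> R) (g : I -> R -> R)
    (e : 'rV[R]_n) :
  i \in A -> (forall m, continuous (g m)) ->
  (forall x, f x = \sum_(m in A) g m (dotv (a m) x)) ->
  dotv (a i) e != 0 -> (forall x, derivable f x e) -> continuous ('D_e f) ->
  is_C1 (g i).
Proof.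
move=> iA cg fE aie df cdf.
have [N] := ubnP #|A|.
elim: N => // N IH in A f g fE iA cg df cdf * => AN.
have cf : continuous f.
  rewrite (funext fE); apply: continuous_bigsum => m x.
  by apply: continuous_comp; [exact: continuous_dotv|exact: cg].
have [/exists_inP[j jA ji]|noj] := boolP [exists j in A, j != i]; last first.
  have Ai m : (m \in A) = (m == i).
    apply/idP/eqP => [mA|->//]; apply/eqP; apply: contraR noj => mi.
    by apply/exists_inP; exists m.
  (* Only the summand [i] is left. It is read off along the line spanned by [e], on which
     [dotv (a i)] is multiplication by [al]. *)
  pose al := dotv (a i) e.
  have gE t : g i t = f (0 + (t * al^-1) *: e).
    rewrite fE (eq_bigl _ _ Ai) big_pred1_eq add0r dotvZr divfK//.
  exists (fun t => 'D_e f (0 + (t * al^-1) *: e) * al^-1).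
    move=> t; apply: cvgM; last exact: cvg_cst.
    apply: (@continuous_comp _ _ _ (fun t : R => t * al^-1)
      (fun u : R => 'D_e f (0 + u *: e))).
      by apply: cvgM; [exact: cvg_id|exact: cvg_cst].
    exact: (@continuous_along _ _ ('D_e f)).
  move=> t; rewrite (funext gE).
  apply: (@is_derive1_comp R (fun u => f (0 + u *: e)) (fun t => t * al^-1)).
    exact: is_derive_line.
  have := @is_deriveM R R (fun x => x) (cst al^-1) t 1 _ _
    (is_derive_id _ _) (is_derive_cst _ _ _).
  by rewrite scaler0 add0r => h; apply: is_derive_eq h _; rewrite [_ *: _]mulr1.
have [b [aib ajb]] : exists b, dotv (a i) b = 1 /\ dotv (a j) b = 0.
  by apply: separated; rewrite eq_sym.
pose f1 (x : 'rV[R]_n) := avg01 (fun h => f (x + h *: b)) - f x.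
pose g1 m t := avg01 (fun h => g m (t + h * dotv (a m) b)) - g m t.
have cg1 m : continuous (g1 m).
  move=> t; apply: cvgB; last exact: cg.
  apply: (@continuous_avg01 _ _ (fun t h => g m (t + h * dotv (a m) b))) => p.
  apply: (@continuous_comp _ _ _ (fun p : R * R => p.1 + p.2 * dotv (a m) b) (g m)).
    apply: cvgD; first exact: cvg_fst.
    by apply: cvgM; [exact: cvg_snd|exact: cvg_cst].
  exact: cg.
have g1j : g1 j = fun=> 0.
  apply/funext => t; rewrite /g1 ajb.
  by under eq_fun do rewrite mulr0 addr0; rewrite avg01_cst subrr.
have f1E (x : 'rV[R]_n) : f1 x = \sum_(m in A :\ j) g1 m (dotv (a m) x).
  have -> : f1 x = \sum_(m in A) g1 m (dotv (a m) x).
    rewrite /f1 fE sumrB; congr (_ - _).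
    rewrite -avg01_sum; last first.
      move=> m h.
      apply: (@continuous_comp _ _ _ (fun h : R => dotv (a m) x + h * dotv (a m) b) (g m)).
        apply: cvgD; first exact: cvg_cst.
        by apply: cvgM; [exact: cvg_id|exact: cvg_cst].
      exact: cg.
    congr avg01; apply/funext => h; rewrite fE; apply: eq_bigr => m _.
    by rewrite dotvDr dotvZr.
  by rewrite (big_setD1 j)//= g1j add0r.
have df1 (x : 'rV[R]_n) : is_derive x e f1
    (avg01 (fun h => 'D_e f (x + h *: b)) - 'D_e f x).
  apply: is_deriveB; first exact: is_derive_avg01.
  exact/derivableP.
have D1E : 'D_e f1 = fun x : 'rV[R]_n =>
    avg01 (fun h => 'D_e f (x + h *: b)) - 'D_e f x.
  by apply/funext => x; have [] := df1 x.
have C1 : is_C1 (g1 i).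
  apply: (IH (A :\ j) f1 g1 f1E) => //.
  - by rewrite in_setD1 iA andbT eq_sym.
  - have cA : continuous (fun x : 'rV[R]_n => avg01 (fun h => 'D_e f (x + h *: b))).
      apply: (@continuous_avg01 R 'rV[R]_n (fun x h => 'D_e f (x + h *: b))).
      exact: (continuous_translates (f := 'D_e f)).
    by rewrite D1E => x; exact: (continuousB (cA x) (cdf x)).
  - by move: AN; rewrite (cardsD1 j) jA.
(* Since [dotv (a i) b = 1], [g i] is a unit-interval average of itself, which is C^1, minus [g1 i],
   which is C^1 by induction. *)
have -> : g i = fun t => avg01 (fun h => g i (t + h)) - g1 i t.
  apply/funext => t; rewrite /g1 aib.
  under [in X in _ = _ - (X - _)]eq_fun do rewrite mulr1.
  by rewrite opprB addrC subrK.
apply: is_C1B C1; exists (fun t => g i (t + 1) - g i t).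
  move=> t; apply: cvgB; last exact: cg.
  apply: (@continuous_comp _ _ _ (fun t : R => t + 1) (g i)); last exact: cg.
  by apply: cvgD; [exact: cvg_id|exact: cvg_cst].
by move=> t; exact: is_derive_avg01_shift.
Qed.

End ridge_regularity.

(** * From C^1 to C^s *)

Lemma derive1nZ (R : realType) (c : R) (g : R -> R) (m : nat) :
  (forall l, (l < m)%N -> forall t : R, derivable (derive1n l g) t 1) ->
  derive1n m (fun t => c * g t) = fun t => c * derive1n m g t.
Proof.
elim: m => // m IH dg.
rewrite derive1nS IH; last by move=> l lm; apply: dg; exact: ltnW.
by apply/funext => t; rewrite derive1nS derive1Ml//; exact: dg.
Qed.

Lemma classC1Z (R : realType) (c : R) (s : nat) (g : R -> R) :
  classC1 s g -> classC1 s (fun t => c * g t).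
Proof.
move=> [dg cg]; split => [m ms t|].
  rewrite derive1nZ; first by apply: derivableM; [exact: derivable_cst|exact: dg].
  by move=> l lm; apply: dg; exact: ltn_trans lm ms.
rewrite derive1nZ// => t.
by apply: cvgM; [exact: cvg_cst|exact: cg].
Qed.

Lemma classC1S (R : realType) (s : nat) (g : R -> R) :
  (forall t : R, derivable g t 1) -> classC1 s (derive1 g) -> classC1 s.+1 g.
Proof.
move=> dg [dg' cg']; split=> [[|m] ms t|].
- exact: dg.
- by rewrite derive1Sn; exact: dg'.
- by rewrite derive1Sn.
Qed.

Lemma classC1_cst (R : realType) (s : nat) (c : R) : classC1 s (fun=> c).
Proof.
elim: s c => [|s IH] c; first by split => // t; exact: cvg_cst.
apply: classC1S => [t|]; first exact: derivable_cst.
have -> : derive1 (fun=> c) = fun=> 0 by apply/funext => t; exact: derive1_cst.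
exact: IH.
Qed.

Lemma derive_ridge_sum (R : realType) (n k : nat) (a : 'I_k -> 'rV[R]_n)
    (g : 'I_k -> R -> R) (e x : 'rV[R]_n) :
  (forall i (t : R), derivable (g i) t 1) ->
  'D_e (fun x => \sum_(i < k) g i (dotv (a i) x)) x =
  \sum_(i < k) dotv (a i) e * derive1 (g i) (dotv (a i) x).
Proof.
move=> dg; pose f y := \sum_(i < k) g i (dotv (a i) y).
rewrite -/f.
have -> : 'D_e f x = 'D_1 (fun u : R => f (x + u *: e)) 0.
  by rewrite derive_line scale0r addr0.
have -> : (fun u : R => f (x + u *: e)) =
    \sum_(i < k) (g i \o (fun u : R => dotv (a i) x + u * dotv (a i) e)).
  apply/funext => u; rewrite fct_sumE; apply: eq_bigr => i _ /=.
  by rewrite dotvDr dotvZr.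
apply: derive_val; apply: is_derive_sum => i.
rewrite mulrC; apply: is_derive1_comp.
  rewrite mul0r addr0 derive1E; exact/derivableP.
have -> : (fun u : R => dotv (a i) x + u * dotv (a i) e) =
   cst (dotv (a i) x) + (dotv (a i) e) *: id.
  by apply/funext => u; rewrite /= mulrC.
apply: is_derive_eq.
by rewrite add0r [_ *: _]mulr1.
Qed.

(** Once [ridge_sum_C1] makes the components C^1, a partial derivative of [f] is again a ridge sum
    with continuous components, of class [s] by induction. *)
Lemma ridge_sum_classC1 (R : realType) (n k s : nat) (a : 'I_k -> 'rV[R]_n)
    (f : 'rV[R]_n -> R) (g : 'I_k -> R -> R) :
  (forall i j, i != j -> exists b, dotv (a i) b = 1 /\ dotv (a j) b = 0) ->
  (forall i, a i != 0) ->
  classC s f -> (forall i, continuous (g i)) ->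
  (forall x, f x = \sum_(i < k) g i (dotv (a i) x)) ->
  forall i, classC1 s (g i).
Proof.
move=> sep a0; elim: s f g => [|s IH] f g fC cg fE i.
  by split => //; exact: cg.
have [j_ jP] : {j_ : 'I_k -> 'I_n & forall m, a m 0 (j_ m) != 0}.
  apply: (@choice _ _ (fun m j => a m 0 j != 0)) => m.
  by have /rV0Pn[j] := a0 m; exists j.
case: fC => cf dfC.
have C1g m : is_C1 (g m).
  have [df dfC'] := dfC (j_ m).
  apply: (@ridge_sum_C1 R n 'I_k a sep (finset.setTfor 'I_k) m f g
    (delta_mx 0 (j_ m))) => //.
  - by move=> x; rewrite fE; apply: eq_bigl => l; rewrite inE.
  - by rewrite dotv_delta.
  - by case: (s) dfC' => [//|? []].
have dg m (t : R) : derivable (g m) t 1 by have [g' _ /(_ t)[]] := C1g m.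
have cg' m : continuous (derive1 (g m)).
  have [g' cg' dg'] := C1g m.
  suff -> : derive1 (g m) = g' by [].
  by apply/funext => t; rewrite derive1E; have [] := dg' t.
apply: classC1S => //.
(* The coordinate is chosen for [i]: the coefficients of other summands may vanish, but that of
   [derive1 (g i)] can be divided out. *)
have [_ /IH] := dfC (j_ i).
move=> /(_ (fun m t => a m 0 (j_ i) * derive1 (g m) t)) H.
have {}H : classC1 s (fun t => a i 0 (j_ i) * derive1 (g i) t).
  apply: H => [m t|x]; first by apply: cvgM; [exact: cvg_cst|exact: cg'].
  rewrite (funext fE) derive_ridge_sum//.
  by apply: eq_bigr => m _; rewrite dotv_delta.
have -> : derive1 (g i) =
    fun t => (a i 0 (j_ i))^-1 * (a i 0 (j_ i) * derive1 (g i) t).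
  by apply/funext => t; rewrite mulKf.
exact: classC1Z.
Qed.

(** * Continuous components *)

Lemma rat_near (R : realType) (x e : R) : 0 < e ->
  exists q : rat, `|ratr q - x| < e.
Proof.
move=> e0; have /rat_in_itvoo[q] : x - e < x + e by lra.
by rewrite in_itv /= => ?; exists q; rewrite ltr_distl.
Qed.

(** The oscillation of [phi] near any real point tends to 0, so [phi] has a limit there along the
    rationals; these limits form [g]. *)
Lemma continuous_extension_rat (R : realType) (phi : rat -> R) :
  small_diffs 0 phi ->
  exists2 g : R -> R, continuous g & forall q, g (ratr q) = phi q.
Proof.
move=> sphi.
have osc (x e : R) : 0 < e -> exists2 d : R, 0 < d & forall q q' : rat,
    `|ratr q - x| < d -> `|ratr q' - x| < d -> `|phi q - phi q'| <= e.
  move=> e0.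
  pose M := (Num.bound (`|x| + 1)).
  have xM : `|x| + 1 < M%:R by rewrite archi_boundP// addr_ge0.
  have [d d0 Hd] := sphi M e e0.
  exists (Num.min 1 (ratr d / 2)) => [|q q'].
    by rewrite lt_min ltr01 divr_gt0// ltr0q.
  rewrite !lt_min => /andP[q1 qd] /andP[q1' qd'].
  have := Hd (q - q') [::] q' erefl isT; rewrite /= [_ + (q - _)]addrC subrK; apply.
    rewrite -(ler_rat R) ratr_norm ratr_nat ltW// (le_lt_trans _ xM)//.
    rewrite -[ratr q'](subrK x) (le_trans (ler_normD _ _))// addrC lerD2l.
    exact: ltW.
  rewrite -(ler_rat R) ratr_norm rmorphB /=.
  rewrite (_ : ratr q - _ = (ratr q - x) - (ratr q' - x)); last by ring.
  by rewrite (le_trans (ler_normB _ _))//; lra.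
have ex (x : R) : exists y : R, forall e, 0 < e -> exists2 d : R, 0 < d &
    forall q : rat, `|ratr q - x| < d -> `|phi q - y| <= e.
  (* The supremum of [S] is the lower limit of [phi] at [x]; [key] locates it within [e] of every
     value of [phi] close to [x]. *)
  pose S := [set r : R | exists2 d : R, 0 < d &
    forall q : rat, `|ratr q - x| < d -> r <= phi q].
  have key (e d : R) (q0 : rat) : 0 < d -> (forall q q' : rat,
      `|ratr q - x| < d -> `|ratr q' - x| < d -> `|phi q - phi q'| <= e) ->
      `|ratr q0 - x| < d -> S (phi q0 - e) /\ ubound S (phi q0 + e).
    move=> d0 Hd q0d; split.
      exists d => // q qd.
      by have := Hd _ _ q0d qd; rewrite ler_norml => /andP[_]; lra.
    move=> r [d' d'0 Hr].
    have [|q] := @rat_near R x (Num.min d d').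
      by rewrite lt_min d0.
    rewrite lt_min => /andP[qd qd'].
    rewrite (le_trans (Hr _ qd'))//.
    by have := Hd _ _ q0d qd; rewrite ler_norml => /andP[? ?]; lra.
  exists (sup S) => e e0; have [d d0 Hd] := osc x e e0.
  exists d => // q qd; have [Sq Uq] := key _ _ _ d0 Hd qd.
  have h1 : phi q - e <= sup S by apply: ub_le_sup => //; exists (phi q + e).
  have h2 : sup S <= phi q + e by apply: ge_sup => //; exists (phi q - e).
  by rewrite ler_distl; lra.
have [g gP] := choice ex.
exists g => [x|q].
  apply/cvgrPdist_le => e e0; have e20 : 0 < e / 2 by rewrite divr_gt0.
  have [d d0 Hd] := gP x _ e20.
  apply/nbhs_ballP; exists (d / 2); first by rewrite /= divr_gt0.
  move=> y; rewrite /ball/= => xy.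
  have [d' d'0 Hd'] := gP y _ e20.
  have [|q] := @rat_near R y (Num.min (d / 2) d').
    by rewrite lt_min divr_gt0.
  rewrite lt_min => /andP[qd qd'].
  have h1 := Hd' _ qd'.
  have h2 : `|phi q - g x| <= e / 2.
    apply: Hd; rewrite (_ : ratr q - x = (ratr q - y) - (x - y)); last by ring.
    by rewrite (le_lt_trans (ler_normB _ _))// [ltRHS]splitr ltrD.
  rewrite (_ : g x - g y = (phi q - g y) - (phi q - g x)); last by ring.
  by rewrite (le_trans (ler_normB _ _))// [leRHS]splitr lerD.
apply/eqP; rewrite eq_sym -subr_eq0 -normr_le0; apply/ler_addgt0Pl => e e0.
rewrite addr0; have [d d0 Hd] := gP (ratr q) _ e0.
by apply: Hd; rewrite subrr normr0.
Qed.

(** * Separating directions and density of rational vectors *)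

Section dotv_geometry.
Context {R : realType} {n : nat}.
Implicit Types a b x y : 'rV[R]_n.

Lemma dotvC a b : dotv a b = dotv b a.
Proof. by apply: eq_bigr => j _; rewrite mulrC. Qed.

Lemma dotv_eq0 a : (dotv a a == 0) = (a == 0).
Proof.
apply/eqP/eqP => [/eqP|->]; last exact: dotv0l.
rewrite psumr_eq0 => [/allP aa|j _]; last exact: sqr_ge0.
apply/rowP => j; have := aa j (mem_index_enum j).
by rewrite mulf_eq0 orbb mxE => /eqP.
Qed.

Lemma free_neq0 a b : free [:: a; b] -> a != 0 /\ b != 0.
Proof.
rewrite free_cons seq1_free => /andP[ab ->]; split=> //.
by apply: contraNneq ab => ->; exact: mem0v.
Qed.

(** Up to scaling, the witness is the component of [a] orthogonal to [b]. *)
Lemma free_separated a b : free [:: a; b] ->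
  exists c, dotv a c = 1 /\ dotv b c = 0.
Proof.
move=> fab; have [_ b0] := free_neq0 fab.
pose c := dotv b b *: a + - dotv a b *: b.
have bc0 : dotv b c = 0.
  by rewrite /c dotvDr !dotvZr [dotv b a]dotvC; ring.
(* As [c] is a combination of [a] and [b], being orthogonal to both would force [dotv c c = 0],
   hence [c = 0], a linear relation. *)
have ac0 : dotv a c != 0.
  apply/eqP => ac0; have : c == 0.
    rewrite -dotv_eq0 {2}/c dotvDr !dotvZr ![dotv c _]dotvC ac0 bc0.
    by rewrite !mulr0 addr0.
  rewrite /c scaleNr subr_eq0 => /eqP bba.
  move: fab; rewrite free_cons => /andP[/negP + _]; apply.
  rewrite span_seq1; apply/vlineP; exists ((dotv b b)^-1 * dotv a b).
  by rewrite -scalerA -bba scalerK// dotv_eq0.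
by exists ((dotv a c)^-1 *: c); rewrite !dotvZr bc0 mulr0 mulVf.
Qed.

(* The adjoint of [T] is surjective because [T] is, hence maps the rational
   points onto a dense set. *)
Lemma linear_adjoint (T : {linear 'rV[R]_n -> 'rV[R]_n}) : bijective T ->
  exists S : 'M[R]_n, S \in unitmx /\
    forall a y, dotv a (y *m S) = dotv (T a) y.
Proof.
move=> [T' TK T'K]; pose M := lin1_mx T.
have TM v : T v = v *m M by rewrite mul_rV_lin1.
exists M^T; split.
  rewrite unitmx_tr.
  have : (\matrix_i T' (delta_mx 0 i)) *m M = 1%:M.
    by apply/row_matrixP => i; rewrite row_mul rowK -TM T'K row1.
  by case/mulmx1_unit.
move=> a y.
have dotvE (u v : 'rV[R]_n) : dotv u v = (u *m v^T) 0 0.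
  by rewrite mxE; apply: eq_bigr => j _; rewrite mxE.
by rewrite !dotvE trmx_mul trmxK mulmxA -TM.
Qed.

Lemma dotv_rat (p q : 'rV[rat]_n) :
  dotv (map_mx ratr p) (map_mx ratr q) = ratr (\sum_j p 0 j * q 0 j) :> R.
Proof. by rewrite rmorph_sum; apply: eq_bigr => j _; rewrite !mxE rmorphM. Qed.

Lemma eq_on_rational_vectors (f g : 'rV[R]_n -> R) :
  continuous f -> continuous g ->
  (forall q : 'rV[rat]_n, f (map_mx ratr q) = g (map_mx ratr q)) -> f =1 g.
Proof.
move=> cf cg fg x.
apply/eqP; rewrite -subr_eq0 -normr_le0; apply/ler_addgt0Pl => e e0; rewrite addr0.
have e20 : 0 < e / 2 by rewrite divr_gt0.
have /cvgrPdist_le/(_ _ e20) fx := cf x.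
have /cvgrPdist_le/(_ _ e20) gx := cg x.
have /nbhs_ballP[d /= d0 Hd] : \forall y \near x,
    `|f x - f y| <= e / 2 /\ `|g x - g y| <= e / 2.
  by apply: filterI.
have [q qP] : {q : 'I_n -> rat & forall j, `|ratr (q j) - x 0 j| < d}.
  by apply: (@choice _ _ (fun j q => `|ratr q - x 0 j| < d)) => j; exact: rat_near.
have /Hd[] : ball x d (map_mx ratr (\row_j q j)).
  by split=> // i j; rewrite !mxE ord1 /ball /= distrC.
rewrite fg; set z := g _ => h1 h2.
rewrite (_ : f x - g x = (f x - z) - (g x - z)); last by ring.
by rewrite (le_trans (ler_normB _ _))// [leRHS]splitr lerD.
Qed.

Lemma continuous_mulmxr (S : 'M[R]_n) : continuous (fun y : 'rV[R]_n => y *m S).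
Proof.
under eq_fun do rewrite mulmx_sum_row.
apply: continuous_bigsum => j x.
apply: (@cvgZr_tmp R 'rV[R]_n 'rV[R]_n (nbhs x) _ (fun y => y 0 j)).
exact: coord_continuous.
Qed.

End dotv_geometry.

(** * Uniform bounds on balls *)

Lemma norm_ball_compact (R : realType) (n : nat) (r : R) :
  compact [set y : 'rV[R]_n | `|y| <= r].
Proof.
apply: bounded_closed_compact.
  by exists r; split=> [|s rs y /= yr]; [exact: num_real|exact: le_trans yr (ltW rs)].
apply: (closed_comp (f := fun y : 'rV[R]_n => `|y|) (D := [set s | s <= r])).
  by move=> y _; exact: norm_continuous.
exact: closed_le.
Qed.

Lemma continuous_bounded_on_balls (R : realType) (n : nat)
    (f : 'rV[R]_n -> R) (r : R) :
  continuous f -> exists C, forall y, `|y| <= r -> `|f y| <= C.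
Proof.
move=> cf; have /compact_bounded[C [_ HC]] : compact (f @` [set y | `|y| <= r]).
  apply: continuous_compact; last exact: norm_ball_compact.
  exact: continuous_subspaceT.
by exists (C + 1) => y yr; apply: HC; [rewrite ltrDl|exists y].
Qed.

(** The point [y + v] may leave the ball, so compactness is applied to [y] alone, with [v] near 0 as
    the parameter. *)
Lemma uniformly_continuous_on_balls (R : realType) (n : nat) (f : 'rV[R]_n -> R)
    (r e : R) : continuous f -> 0 < e ->
  exists2 d : R, 0 < d &
    forall v y, `|v| < d -> `|y| <= r -> `|f (y + v) - f y| <= e.
Proof.
move=> cf e0.
have /compact_near_coveringP/(_ 'rV[R]_n (nbhs (0 : 'rV[R]_n))) :=
  @norm_ball_compact R n r.
move=> /(_ (fun v y => `|f (y + v) - f y| <= e)) H.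
have /nbhs_ballP[d /= d0 Hd] : \forall v \near (0 : 'rV[R]_n),
    forall y, `|y| <= r -> `|f (y + v) - f y| <= e.
  apply: H => y _.
  pose F (p : 'rV[R]_n * 'rV[R]_n) := f (p.1 + p.2) - f p.1.
  have cF : {for (y, 0), continuous F}.
    apply: (@continuousB R R _
      (fun p : 'rV[R]_n * 'rV[R]_n => f (p.1 + p.2)) (fun p => f p.1)).
      apply: (@continuous_comp _ _ _ (fun p : 'rV[R]_n * 'rV[R]_n => p.1 + p.2) f).
        by apply: cvgD; [exact: cvg_fst|exact: cvg_snd].
      exact: cf.
    apply: (@continuous_comp _ _ _ (@fst 'rV[R]_n 'rV[R]_n) f); last exact: cf.
    exact: cvg_fst.
  have /cvgrPdist_le/(_ _ e0) := cF.
  rewrite /F /= addr0 subrr; apply: filterS => -[y' v] /=.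
  by rewrite sub0r normrN.
by exists d => // v y vd; apply: Hd; rewrite -ball_normE /= sub0r normrN.
Qed.

(** * Differences of a single component *)

Section components.
Context {R : realType} {n k : nat} (a : 'I_k -> 'rV[R]_n).
Context (f : 'rV[R]_n -> R) (f_ : 'I_k -> R -> R).
Hypothesis f_sum : forall x, f x = \sum_(i < k) f_ i (dotv (a i) x).
Hypothesis f_cont : continuous f.
Context (i : 'I_k) (b : 'I_k -> 'rV[R]_n) (c : 'rV[R]_n).
Hypothesis bP : forall j, j != i -> dotv (a i) (b j) = 1 /\ dotv (a j) (b j) = 0.
Hypothesis cP : dotv (a i) c = 1.

Let others : seq 'I_k := enum [pred j | j != i].
Let phi (q : rat) : R := f_ i (ratr q).
(** One step for each summand to be killed; [dotv (a i)] maps these vectors back to the rational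
    steps [hs]. *)
Let steps (hs : seq rat) := [seq ratr p.1 *: b p.2 | p <- zip hs others].

(* The step along [b j] annihilates the [j]-th summand, so only the [i]-th one
   contributes to the difference. *)
Lemma component_diffs (pre hs : seq rat) (t : rat) : size hs = size others ->
  diffs (pre ++ hs) phi t =
  diffs ([seq ratr h *: c | h <- pre] ++ steps hs) f (ratr t *: c).
Proof.
move=> sz; rewrite (eq_diffs f_sum) diffs_sum (bigD1 i)//= big1 ?addr0 => [|j ji].
  rewrite (diffs_comp (l := dotv (a i))); last exact: dotvDr.
  rewrite (diffs_comp (l := @ratr R)); last exact: rmorphD.
  rewrite dotvZr cP mulr1 !map_cat; congr (diffs (_ ++ _) _ _).
    by rewrite -map_comp; apply: eq_map => h /=; rewrite dotvZr cP mulr1.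
  rewrite -map_comp -{1}(unzip1_zip (s := hs) (t := others)) ?sz// -map_comp.
  apply/eq_in_map => -[h j] /= /(map_f snd); rewrite -/(unzip2 _) unzip2_zip ?sz//=.
  by rewrite mem_enum inE => /bP[bj _]; rewrite dotvZr bj mulr1.
rewrite (diffs_comp (l := dotv (a j))); last exact: dotvDr.
apply: diffs_mem0; rewrite map_cat mem_cat; apply/orP; right.
(* The step that [zip] pairs with [j] is a multiple of [b j], so [dotv (a j)] sends it to 0. *)
have jo : j \in others by rewrite mem_enum.
rewrite -map_comp; apply/mapP; exists (nth 0 hs (index j others), j).
  rewrite -[X in (_, X)](nth_index j jo) -nth_zip//.
  by rewrite mem_nth// size_zip sz minnn index_mem.
by rewrite /= dotvZr; have [_ ->] := bP ji; rewrite mulr0.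
Qed.

Let B := \sum_j `|b j|.

Let steps_bound (M : nat) hs : all (fun h => `|h| <= M%:R) hs ->
  all (fun v => `|v| <= M%:R * B) (steps hs).
Proof.
rewrite all_map /steps; elim: hs others => [|h hs IH] [|j o] //= /andP[hM hsM].
rewrite IH// andbT normrZ ler_pM//.
  by rewrite -ratr_norm -(ratr_nat R) ler_rat.
by rewrite /B (bigD1 j)//= lerDl sumr_ge0.
Qed.

Let size_steps hs : size hs = size others -> size (steps hs) = size others.
Proof. by move=> sz; rewrite size_map size_zip sz minnn. Qed.

Let MB0 (M : nat) : 0 <= M%:R * B.
Proof. by rewrite mulr_ge0// sumr_ge0. Qed.

(** The ball of this radius contains all points at which a difference with steps [steps hs] and base
    point [ratr t *: c] evaluates [f]. *)
Let radius (M : nat) := M%:R * `|c| + (M%:R * B) *+ size others.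

Let normtc (M : nat) (t : rat) : `|t| <= M%:R -> `|ratr t *: c| <= M%:R * `|c|.
Proof.
by move=> tM; rewrite normrZ ler_wpM2r// -ratr_norm -(ratr_nat R) ler_rat.
Qed.

Lemma component_bounded_diffs : bounded_diffs (size others) phi.
Proof.
move=> M; have [C HC] := continuous_bounded_on_balls (radius M) f_cont.
exists (C *+ 2 ^ size others) => hs t sz hsM tM.
rewrite -[hs]cat0s component_diffs//= -(size_steps sz).
apply: (@diffs_bound _ _ _ _ _ (M%:R * B)) => //; first exact: steps_bound.
move=> y yb; apply: HC; rewrite (le_trans yb)// size_steps// lerD2r.
exact: normtc.
Qed.

(** The extra step [h] is taken along [c]. The increment of [f] by [ratr h *: c] is uniformly small
    on the ball, and the remaining steps multiply the bound by at most [2 ^ size others]. *)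
Lemma component_small_diffs : small_diffs (size others) phi.
Proof.
move=> M e e0; pose e' := e / (2 ^ size others)%:R.
have p0 : 0 < (2 ^ size others)%:R :> R by rewrite ltr0n expn_gt0.
have e'0 : 0 < e' by rewrite divr_gt0.
have [d d0 Hd] := uniformly_continuous_on_balls (radius M) f_cont e'0.
have c1 : 0 < `|c| + 1 by rewrite ltr_wpDl.
have [q q0 qd] : exists2 q : rat, 0 < q & ratr q < d / (`|c| + 1).
  have /rat_in_itvoo[q] : 0 < d / (`|c| + 1) by rewrite divr_gt0.
  by rewrite in_itv /= ltr0q => /andP[]; exists q.
exists q => [//|h hs t sz hsM tM hq].
rewrite -[h :: hs]/([:: h] ++ hs) component_diffs// diffs_step.
have -> : e = e' *+ 2 ^ size (steps hs).
  by rewrite size_steps// -mulr_natr divfK// gt_eqF.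
apply: (@diffs_bound _ _ _ _ _ (M%:R * B)) => //; first exact: steps_bound.
move=> y yb; apply: Hd; last first.
  by rewrite (le_trans yb)// size_steps// lerD2r; exact: normtc.
rewrite normrZ (@le_lt_trans _ _ (ratr q * `|c|))//.
  by rewrite ler_wpM2r// -ratr_norm ler_rat.
move: qd; rewrite ltr_pdivlMr//; apply: le_lt_trans.
by rewrite ler_wpM2l// ?lerDl// ler0q ltW.
Qed.

End components.

(** * Assembling the components *)

Theorem corollary4p2 (R : realType) (n k s : nat) (n_gt0 : (0 < n)%N)
  (k_gt0 : (0 < k)%N) (a : 'I_k -> 'rV[R]_n)
  (a_indep : forall i j : 'I_k, i != j -> free [:: a i; a j])
  (f : 'rV[R]_n -> R) (f_Cs : classC s f)
  (f_ : 'I_k -> R -> R)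
  (f_sum : forall x : 'rV[R]_n, f x = \sum_(i < k) f_ i (dotv (a i) x))
  (T_rational : exists T : {linear 'rV[R]_n -> 'rV[R]_n},
      bijective T /\ forall i : 'I_k, rational_vector (T (a i))) :
  exists g : 'I_k -> R -> R,
    (forall i : 'I_k, classC1 s (g i)) /\
    (forall x : 'rV[R]_n, f x = \sum_(i < k) g i (dotv (a i) x)).
Proof.
have cf : continuous f by case: (s) f_Cs => [|? []].
(* A zero vector belongs to no independent pair, so it must be the only direction, and then [f] is
   constant. *)
have [[i /eqP ai0]|a0] := pselect (exists i, a i == 0).
  have ki j : j = i.
    apply/eqP; apply: contraT => /a_indep/free_neq0[_].
    by rewrite ai0 eqxx.
  have sum1 (F : 'I_k -> R) : \sum_(j < k) F j = F i.
    by rewrite (bigD1 i)//= big1 ?addr0// => j; rewrite (ki j) eqxx.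
  exists (fun _ _ => f 0); split => [j|x]; first exact: classC1_cst.
  by rewrite sum1 !f_sum !sum1 ai0 !dotv0l.
have {}a0 i : a i != 0 by apply/negP => ai0; apply: a0; exists i.
have sep i j : i != j -> exists b, dotv (a i) b = 1 /\ dotv (a j) b = 0.
  by move=> /a_indep/free_separated.
have ext i : exists g : R -> R,
    continuous g /\ forall q, g (ratr q) = f_ i (ratr q).
  have [b bP] : {b : 'I_k -> 'rV[R]_n & forall j, j != i ->
      dotv (a i) (b j) = 1 /\ dotv (a j) (b j) = 0}.
    apply: (@choice _ _ (fun j b => j != i ->
      dotv (a i) b = 1 /\ dotv (a j) b = 0)) => j.
    (* The value at [j = i] is arbitrary. *)
    have [->|ji] := eqVneq j i; first by exists 0.
    by have [|b bP] := sep i j; [rewrite eq_sym|exists b].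
  pose c := (dotv (a i) (a i))^-1 *: a i.
  have cP : dotv (a i) c = 1 by rewrite dotvZr mulVf// dotv_eq0.
  have [g cg gE] := continuous_extension_rat (small_diffs0
    (component_bounded_diffs f_sum cf bP cP)
    (component_small_diffs f_sum cf bP cP)).
  by exists g.
have [g gP] := choice ext.
(* Write [x = y *m S]. For rational [y] each [dotv (a i) x = dotv (T (a i)) y] is rational, and
   there [g i] agrees with [f_ i]; density and continuity give the rest. *)
have fE x : f x = \sum_(i < k) g i (dotv (a i) x).
  have [T [Tbij Trat]] := T_rational.
  have [S [Su ST]] := linear_adjoint Tbij.
  rewrite -(mulmxKV Su x); set y := x *m _.
  apply: (@eq_on_rational_vectors R n (fun y => f (y *m S))
     (fun y => \sum_(i < k) g i (dotv (a i) (y *m S)))).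
  - move=> z; apply: (@continuous_comp _ _ _ (fun y : 'rV[R]_n => y *m S) f).
      exact: continuous_mulmxr.
    exact: cf.
  - apply: continuous_bigsum => i z.
    apply: (@continuous_comp _ _ _ (fun y : 'rV[R]_n => dotv (a i) (y *m S)) (g i)).
      by rewrite (funext (ST (a i))); exact: continuous_dotv.
    by have [cg _] := gP i; exact: cg.
  - move=> q; rewrite f_sum; apply: eq_bigr => i _.
    have [p Tp] := Trat i.
    by rewrite ST Tp dotv_rat; have [_ ->] := gP i.
exists g; split => // i.
by apply: (ridge_sum_classC1 sep a0 f_Cs _ fE) => j; have [] := gP j.
Qed.
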